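(* Let $\Omega\subset\mathbb{R}$ be a nonempty compact set. If $\#\Omega>n$, then the $n$-dimensional polynomial space $\mathcal{P}_{n-1}(\Omega)$ does not have a positive basis in $C(\Omega)$. In particular, if $\Omega$ is infinite, then no polynomial space $\mathcal{P}_m(\Omega)$ can have a positive basis in $C(\Omega)$.
   Context: $C(\Omega)$ is the space of real-valued continuous functions on $\Omega$ with the pointwise order, and $\mathcal{P}_m(\Omega)\subseteq C(\Omega)$ is the space of restrictions to $\Omega$ of real polynomials of degree at most $m$; a function is called positive if it is $\ge 0$ at every point of $\Omega$. A positive basis of a finite-dimensional subspace $X\subseteq C(\Omega)$ is a vector space basis of $X$ consisting of positive functions such that every positive element of $X$ is a linear combination of the basis elements with nonnegative coefficients. $\#\Omega$ denotes the number of elements of $\Omega$.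
   Formalization: Non-existence of a positive basis is stated only for n ≥ 3 (m ≥ 2 in the ''in particular'' part): for n = 1 the constant 1, and for n = 2 the functions max Ω − x and x − min Ω, form a positive basis, so the claim fails there; the dimension claim is kept for all n ≥ 1. *)

(* Defs.v *)
From HB Require Import structures.
From mathcomp Require Import all_boot all_order all_algebra.
From mathcomp Require Import all_classical all_reals all_analysis.

Set Implicit Arguments.
Unset Strict Implicit.
Unset Printing Implicit Defensive.

Import Order.TTheory GRing.Theory Num.Theory.
Import numFieldNormedType.Exports.

Local Open Scope classical_set_scope.
Local Open Scope ring_scope.

(** The library type [continuousType T V] of continuous functions carries no
    vector space structure; it is given the pointwise one here. *)
Section continuous_lmodule.
Context {K : numFieldType} {T : topologicalType} {V : normedModType K}.

Definition cts_pred : {pred T -> V} := mem [set f : T -> V | continuous f].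

Section Sub.
Context (f : T -> V) (fP : f \in cts_pred).
Definition cts_Sub_subproof := @isContinuous.Build T V f (set_mem fP).
#[local] HB.instance Definition _ := cts_Sub_subproof.
Definition cts_Sub : continuousType T V := f.
End Sub.

Lemma cts_rect (P : continuousType T V -> Type) :
  (forall f (Pf : f \in cts_pred), P (cts_Sub Pf)) -> forall u, P u.
Proof.
move=> Psub [f [[Pf]]]/=.
by suff -> : Pf = set_mem (@mem_set _ [set f | _] f Pf) by apply: Psub.
Qed.

Lemma cts_valP f (Pf : f \in cts_pred) : cts_Sub Pf = f :> (T -> V).
Proof. by []. Qed.

HB.instance Definition _ :=
  isSub.Build _ _ (continuousType T V) cts_rect cts_valP.

Lemma cts_submod_closed : submod_closed cts_pred.
Proof.
split=> [|a f g]; rewrite !inE /=.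
  by move=> x; exact: cst_continuous.
move=> cf cg x; apply: cvgD; last exact: cg.
by apply: cvgZl_tmp; exact: cf.
Qed.

HB.instance Definition _ :=
  GRing.isSubmodClosed.Build K (T -> V) cts_pred cts_submod_closed.
HB.instance Definition _ :=
  [SubChoice_isSubLmodule of continuousType T V by <:].

End continuous_lmodule.


(** For a set [Omega], the carrier of [C Omega] consists of functions on the
    subtype [set_type Omega] with its subspace topology, so functions that
    agree on [Omega] are equal. *)
Definition C {R : realType} (Omega : set R) := continuousType Omega R.
HB.instance Definition _ (R : realType) (Omega : set R) :=
  GRing.Lmodule.on (C Omega).

Section positive_basis.
Context {R : realType} {Omega : set R}.
Implicit Types (X : set (C Omega)) (f : C Omega).

Definition is_basis (k : nat) (b : 'I_k -> C Omega) X : Prop :=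
  [/\ forall i, X (b i),
      forall c : 'I_k -> R, \sum_i c i *: b i = 0 -> forall i, c i = 0
    & forall f, X f -> exists c : 'I_k -> R, f = \sum_i c i *: b i].

Definition positive f : Prop := forall t : Omega, 0 <= f t.

Definition is_positive_basis (k : nat) (b : 'I_k -> C Omega) X : Prop :=
  [/\ is_basis b X,
      forall i, positive (b i)
    & forall f, X f -> positive f ->
        exists2 c : 'I_k -> R, (forall i, 0 <= c i) & f = \sum_i c i *: b i].

Definition has_dim (k : nat) X : Prop :=
  exists b : 'I_k -> C Omega, is_basis b X.

Definition has_positive_basis X : Prop :=
  exists (k : nat) (b : 'I_k -> C Omega), is_positive_basis b X.

End positive_basis.

Section polynomial_space.
Context {R : realType} (Omega : set R).

Lemma restr_poly_continuous (p : {poly R}) :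
  continuous (fun t : Omega => p.[\val t]).
Proof.
move=> t; apply: (@continuous_comp _ _ _ (\val : Omega -> R) (horner p)).
  exact: initial_continuous.
exact: continuous_horner.
Qed.

Definition restr_poly (p : {poly R}) : C Omega :=
  mkcts (@restr_poly_continuous p).

(** [size p] is [deg p + 1], and is [0] for the zero polynomial. *)
Definition poly_space (m : nat) : set (C Omega) :=
  restr_poly @` [set p : {poly R} | (size p <= m.+1)%N].

End polynomial_space.

Arguments restr_poly {R} Omega p.
Arguments poly_space {R} Omega m.

(* Main.v *)
Require Import Defs.
From mathcomp Require Import all_boot all_order all_algebra.
From mathcomp Require Import all_classical all_reals all_analysis.

Import Order.TTheory GRing.Theory Num.Theory.
Import numFieldNormedType.Exports.

Local Open Scope classical_set_scope.
Local Open Scope ring_scope.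

(** If [b] is a positive basis, every [b i] has a node [t i] in [Omega] at which
    all the other [b j] vanish: otherwise the sum of the other [b j] is bounded
    below by a positive constant on the compact set [Omega], so that some
    multiple of it dominates [b i], and the difference is a positive function
    with coefficient [-1] on [b i]. Hence a function of the space that is
    nonnegative at the nodes has nonnegative coefficients and is nonnegative on
    [Omega]. There are at most as many nodes as the dimension, so [Omega]
    contains a point [s] that is not a node, and the quadratic polynomial
    [(x - s)^2 - e], for small [e > 0], is nonnegative at the nodes but negative
    at [s]. *)

Lemma cts_lincombE {R : realType} {Omega : set R} {I : Type} (r : seq I)
    (P : pred I) (c : I -> R) (b : I -> C Omega) (t : Omega) :
  (\sum_(i <- r | P i) c i *: b i) t = \sum_(i <- r | P i) c i * b i t.
Proof.
have evalD (f g : C Omega) : (f + g) t = f t + g t by [].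
have evalZ (a : R) (f : C Omega) : (a *: f) t = a * f t by [].
elim: r => [|i r IHr]; first by rewrite !big_nil.
by rewrite !big_cons; case: ifP => _ //; rewrite evalD evalZ IHr.
Qed.

Lemma cts_ext {R : realType} {Omega : set R} (f g : C Omega) :
  (forall t, f t = g t) -> f = g.
Proof. by move=> fg; apply: val_inj; apply: funext => t; exact: fg. Qed.

Lemma restr_polyE {R : realType} {Omega : set R} (p : {poly R}) (t : Omega) :
  restr_poly Omega p t = p.[\val t].
Proof. by []. Qed.

(** Root counting and the choice of a point off the nodes both use the cardinality bound in this
    list form. *)
Lemma card_ge_uniq_seq {T : choiceType} {A : set T} {n : nat} :
  (`I_n #<= A)%card ->
  exists s : seq T, [/\ uniq s, size s = n & forall x, x \in s -> A x].
Proof.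
move=> /card_leP[f].
have mem_ord (i : 'I_n) : (i : nat) \in `I_n by apply/mem_set => /=.
pose g (i : 'I_n) : T := \val (f (SigSub (mem_ord i))).
exists [seq g i | i <- enum 'I_n]; split.
- rewrite map_inj_uniq ?enum_uniq // => i j /val_inj eqf; apply: val_inj.
  by have [] := inj (mem_setT _) (mem_setT _) eqf.
- by rewrite size_map size_enum_ord.
- by move=> x /mapP[i _ ->]; exact: set_valP.
Qed.

Lemma poly_eq0_on {R : realType} {Omega : set R} {n : nat} (p : {poly R}) :
  (`I_n #<= Omega)%card -> (size p <= n)%N ->
  (forall x, Omega x -> p.[x] = 0) -> p = 0.
Proof.
move=> /card_ge_uniq_seq[s [s_uniq s_size sO]] p_size p0.
apply/eqP/negPn/negP => p_neq0.
have /(max_poly_roots p_neq0)/(_ s_uniq) : all (root p) s.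
  by apply/allP => x /sO /p0 px; apply/rootP.
by rewrite s_size ltnNge p_size.
Qed.

Lemma poly_dominated {R : realType} {Omega : set R} (p q : {poly R}) :
  Omega !=set0 -> compact Omega -> (forall x, Omega x -> 0 < q.[x]) ->
  exists M : R, forall x, Omega x -> p.[x] <= M * q.[x].
Proof.
move=> O0 cO q_gt0.
have cts (r : {poly R}) : {within Omega, continuous (horner r)}.
  by apply: continuous_subspaceT; exact: continuous_horner.
have [c _ p_le] := compact_EVT_max O0 cO (cts p).
have [d /set_mem/q_gt0 qd_gt0 q_ge] := compact_EVT_min O0 cO (cts q).
(* The absolute value makes the factor nonnegative, so it can multiply [q.[d] <= q.[x]]. *)
exists (`|p.[c]| / q.[d]) => x /mem_set Ox.
rewrite (le_trans (p_le x Ox)) // (le_trans (ler_norm _)) //.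
by rewrite mulrAC ler_pdivlMr // ler_wpM2l // q_ge.
Qed.

(** The monomials form a basis: a vanishing combination is a polynomial of size at most [m.+1] with
    at least [m.+1] roots. *)
Lemma poly_space_has_dim {R : realType} {Omega : set R} {m : nat} :
  (`I_m.+1 #<= Omega)%card -> has_dim m.+1 (poly_space Omega m).
Proof.
move=> cardO.
exists (fun i : 'I_m.+1 => restr_poly Omega 'X^i); split.
- by move=> i; exists 'X^i => //=; rewrite size_polyXn.
- move=> c c0 i.
  pose p := \poly_(j < m.+1) c (inord j).
  suff p0 : p = 0.
    by have := congr1 (coefp i) p0; rewrite /= coef_poly ltn_ord inord_val coef0.
  apply: (poly_eq0_on p cardO); first exact: size_poly.
  move=> x Ox; have := congr1 (fun f : C Omega => f (SigSub (mem_set Ox))) c0.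
  rewrite cts_lincombE => sum0; rewrite horner_poly -[RHS]sum0.
  by apply: eq_bigr => j _; rewrite inord_val restr_polyE hornerXn.
- move=> _ [p p_size <-]; exists (fun i => p`_i); apply: cts_ext => t.
  rewrite cts_lincombE restr_polyE (horner_coef_wide _ p_size).
  by apply: eq_bigr => j _; rewrite restr_polyE hornerXn.
Qed.

Lemma positive_basis_node {R : realType} {Omega : set R} {m k : nat}
    (b : 'I_k -> C Omega) (i : 'I_k) :
  Omega !=set0 -> compact Omega ->
  is_positive_basis b (poly_space Omega m) ->
  exists t : Omega, forall j, j != i -> b j t = 0.
Proof.
move=> O0 cO [[bX bfree _] bpos bcone].
have /choice[p pP] (j : 'I_k) :
    exists p : {poly R}, (size p <= m.+1)%N /\ restr_poly Omega p = b j.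
  by have [p] := bX j; exists p.
have pE j t : (p j).[\val t] = b j t by rewrite -(pP j).2.
apply: contrapT => no_node.
pose q := \sum_(j | j != i) p j.
have q_gt0 x : Omega x -> 0 < q.[x].
  move=> Ox; pose t : Omega := SigSub (mem_set Ox).
  have qE : q.[x] = \sum_(j | j != i) b j t.
    by rewrite horner_sum; apply: eq_bigr => j _; rewrite -pE.
  rewrite lt_neqAle qE sumr_ge0 ?andbT => [|j _]; last exact: bpos.
  apply/eqP => /esym sum0; apply: no_node; exists t => j.
  by apply: (psumr_eq0P _ sum0) => l _; exact: bpos.
have [M pi_le] := poly_dominated (p i) q O0 cO q_gt0.
(* These are the coordinates of [M *: q - p i] in the basis [b]. *)
pose d (j : 'I_k) : R := if j == i then -1 else M.
have fE : restr_poly Omega (M *: q - p i) = \sum_j d j *: b j.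
  apply: cts_ext => t; rewrite cts_lincombE (bigD1 i) //= /d eqxx mulN1r addrC.
  rewrite restr_polyE hornerD hornerN hornerZ pE horner_sum mulr_sumr; congr (_ - _).
  by apply: eq_bigr => j /negPf ->; rewrite pE.
have [||c c_ge0] := bcone (restr_poly Omega (M *: q - p i)).
- exists (M *: q - p i) => //=.
  rewrite (leq_trans (size_polyD _ _)) // size_polyN geq_max (pP i).1 andbT.
  rewrite (leq_trans (size_scale_leq _ _)) // (leq_trans (size_sum _ _ _)) //.
  by apply/bigmax_leqP => j _; exact: (pP j).1.
- move=> t; rewrite restr_polyE hornerD hornerN hornerZ subr_ge0 pi_le //.
  exact: set_valP.
(* Coordinates are unique, so the nonnegative [c i] would equal [d i = -1]. *)
move=> cE; have /bfree/(_ i)/eqP : \sum_j (d j - c j) *: b j = 0.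
  under eq_bigr do rewrite scalerBl.
  by rewrite sumrB -fE -cE subrr.
rewrite /d eqxx subr_eq0 => /eqP ci.
by have := c_ge0 i; rewrite -ci ler0N1.
Qed.

Lemma poly_space_no_positive_basis {R : realType} {Omega : set R} {m : nat} :
  Omega !=set0 -> compact Omega -> (2 <= m)%N -> (`I_m.+2 #<= Omega)%card ->
  ~ has_positive_basis (poly_space Omega m).
Proof.
move=> O0 cO m_ge2 cardO [k [b b_basis]].
have /choice[t tP] i := positive_basis_node b i O0 cO b_basis.
have [[bX _ bspan] bpos _] := b_basis.
have lincomb_node (c : 'I_k -> R) i : (\sum_j c j *: b j) (t i) = c i * b i (t i).
  rewrite cts_lincombE (bigD1 i) //= big1 ?addr0 // => j ji.
  by rewrite tP ?mulr0.
(* Otherwise all of [b] vanishes at [t i], and then so does the constant 1, which lies in the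
   span. *)
have bt_gt0 i : 0 < b i (t i).
  rewrite lt_neqAle bpos andbT eq_sym; apply/eqP => bti0.
  have [|c /(congr1 (fun f : C Omega => f (t i)))] := bspan (restr_poly Omega 1).
    by exists 1 => //=; rewrite size_poly1.
  by rewrite lincomb_node bti0 mulr0 restr_polyE hornerC => /eqP; rewrite oner_eq0.
have t_inj : injective (fun i => \val (t i)).
  move=> i j /val_inj tij; apply/eqP/negPn/negP => ij.
  by have := bt_gt0 i; rewrite tij (tP j i ij) ltxx.
have k_le : (k <= m.+1)%N.
  (* [b ord0] vanishes at the [k] nodes [t i] with [i != ord0]. *)
  case: k => [//|k] in b b_basis t tP bX bspan bpos lincomb_node bt_gt0 t_inj *.
  have [p p_size pE] := bX ord0.
  have p_neq0 : p != 0.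
    apply/eqP => p0; have := bt_gt0 ord0.
    by rewrite -pE p0 restr_polyE horner0 ltxx.
  pose u := [seq \val (t (lift ord0 i)) | i <- enum 'I_k].
  have u_root : all (root p) u.
    apply/allP => _ /mapP[i _ ->]; apply/rootP.
    by rewrite -restr_polyE pE tP // neq_lift.
  have u_uniq : uniq u.
    by rewrite map_inj_uniq ?enum_uniq // => i j /t_inj/lift_inj.
  have := max_poly_roots p_neq0 u_root u_uniq.
  by rewrite size_map size_enum_ord => /leq_trans/(_ p_size).
have [s sO s_node] : exists2 s, Omega s & forall i, \val (t i) != s.
  have [u [u_uniq u_size uO]] := card_ge_uniq_seq cardO.
  (* Pigeonhole: [m.+2] distinct points against at most [m.+1] nodes. *)
  have /allPn[s su s_node] : ~~ all (mem [seq \val (t i) | i <- enum 'I_k]) u.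
    apply/negP => /allP /(uniq_leq_size u_uniq).
    by rewrite u_size size_map size_enum_ord => /leq_trans/(_ k_le); rewrite ltnn.
  exists s => [|i]; first exact: uO.
  by apply: contraNneq s_node => <-; apply: map_f; rewrite mem_enum.
(* The least squared distance from [s] to a node, capped at 1, which also gives a positive value
   when there are no nodes. *)
pose e : R := \big[Order.min/1]_i (\val (t i) - s) ^+ 2.
have e_gt0 : 0 < e.
  rewrite /e; elim/big_ind: _ => [//|x y x0 y0|i _]; first by rewrite lt_min x0.
  by rewrite exprn_even_gt0 //= subr_eq0 s_node.
pose p : {poly R} := ('X - s%:P) ^+ 2 - e%:P.
have pE x : p.[x] = (x - s) ^+ 2 - e by rewrite !hornerE.
have [|c cE] := bspan (restr_poly Omega p).
  exists p => //=; rewrite (leq_trans (size_polyD _ _)) // size_polyN.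
  by rewrite geq_max size_exp_XsubC size_polyC ltnS m_ge2; case: (e != 0).
(* At [t i] the expansion of [p] reduces to [c i * b i (t i)], so [c i] has the sign of [p]
   there. *)
have c_ge0 i : 0 <= c i.
  rewrite -(pmulr_lge0 _ (bt_gt0 i)) -lincomb_node -cE restr_polyE pE subr_ge0.
  exact: bigmin_le.
have : 0 <= restr_poly Omega p (SigSub (mem_set sO)).
  by rewrite cE cts_lincombE sumr_ge0 // => j _; rewrite mulr_ge0 ?bpos.
by rewrite restr_polyE pE subrr expr0n /= sub0r oppr_ge0 leNgt e_gt0.
Qed.

(** The bounds [3 <= n] and [2 <= m] exclude genuine exceptions: 1 is a positive basis of the
    constants, and if [Omega] has minimum a < b its maximum, then x - a and b - x form a positive
    basis of the affine functions. *)
Theorem corollary8 (R : realType) (Omega : set R)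
    (Omega_neq0 : Omega !=set0) (Omega_compact : compact Omega) :
  (forall n : nat, (0 < n)%N -> (`I_n.+1 #<= Omega)%card ->
     has_dim n (poly_space Omega n.-1) /\
     ((3 <= n)%N -> ~ has_positive_basis (poly_space Omega n.-1))) /\
  (infinite_set Omega ->
     forall m : nat, (2 <= m)%N -> ~ has_positive_basis (poly_space Omega m)).
Proof.
split=> [[//|m] _ cardO|/infiniteP cardO m m_ge2].
  split=> [|m_ge2]; last exact: poly_space_no_positive_basis.
  by apply: poly_space_has_dim; apply: card_le_trans cardO; rewrite card_le_II.
apply: poly_space_no_positive_basis => //.
by apply: card_le_trans cardO; exact: subset_card_le.
Qed.
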